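(* Let $G=\mathbb{Z}/3\mathbb{Z}$ with generator $\omega$ (written multiplicatively), and let $Q$ be a quiver with an action of $G$ by quiver isomorphisms, with orbits $O_1,\dots,O_m$, chosen representatives $x_i\in O_i$, and folded exchange matrix $B=B^Q_G(x_1,\dots,x_m)=(b_{ij})$. Suppose $b_{kk}=\omega-\omega^{-1}$ for some index $k$. Let $Q'$ be the quiver obtained from $Q$ by the generalized mutation at the orbit $O_k$. Then $Q'$ is again invariant under the action of $G$, and its folded exchange matrix $B^{Q'}_G(x_1,\dots,x_m)=(b'_{ij})$ is given as follows. For $i=k$ or $j=k$, $$b'_{ij}=b_{ij}-\big[\omega^{-1}b_{ij}+[b_{ij}]_+\big]_+-\big[\omega b_{ij}+[b_{ij}]_-\big]_- ,$$ and otherwise $$b'_{ij}=b_{ij}+\tfrac13\Big(b_{ik}\circ b_{kj}-b'_{ik}\circ b'_{kj}+(\omega^{-1}b_{ik}+[b_{ik}]_+)\circ(\omega b_{kj}+[b_{kj}]_-)+(\omega b_{ik}+[b_{ik}]_-)\circ(\omega^{-1}b_{kj}+[b_{kj}]_+)\Big).$$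
   Context: A quiver is a finite directed graph (multiple arrows allowed) without loops and without oriented 2-cycles. Its exchange matrix $(\beta_{uv})$ is the skew-symmetric integer matrix with $\beta_{uv}=l$ if there are $l$ arrows from $u$ to $v$, $-l$ if there are $l$ arrows from $v$ to $u$, and $0$ otherwise. $G$ acts by quiver isomorphisms if $\beta_{g\cdot u,\,g\cdot v}=\beta_{uv}$ for all $g\in G$ and all nodes $u,v$. Mutation $\mu_v$ at a node $v$: for every pair of arrows $u\to v$, $v\to w$ add an arrow $u\to w$; remove oriented 2-cycles; reverse all arrows incident to $v$. Folded exchange matrix: with $H_j=\mathrm{Stab}_G(x_j)$, $B^Q_G(x_1,\dots,x_m)=(b_{ij})$ is the $m\times m$ matrix over $\mathbb{Z}[G][|G|^{-1}]$ (the group ring of $G$ over $\mathbb{Z}[1/|G|]$) with $b_{ij}=\frac{1}{|H_j|}\sum_{g\in G}\beta_{x_i,\,g\cdot x_j}\,g$. A quiver $Q$ with $G$-action whose folded exchange matrix is $B$ is called a symmetric unfolding of $B$. For $a=\sum_g a_g g$ put $[a]_+=\sum_g\max(a_g,0)\,g$ and $[a]_-=\sum_g\min(a_g,0)\,g$, and $a\circ b=[a]_+[b]_+-[a]_-[b]_-$. Generalized mutation at $O_k$: the condition $b_{kk}=\omega-\omega^{-1}$ means that the nodes $k_1=x_k$, $k_2=\omega x_k$, $k_3=\omega^2x_k$ of $O_k$ form an oriented 3-cycle $k_1\to k_2\to k_3\to k_1$ of single arrows. The generalized mutation at $O_k$ mutates $Q$ successively at $k_1,k_2,k_3,k_1$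 and then relabels the nodes by exchanging $k_2$ and $k_3$ (all other nodes keep their labels). The ''mutation of $B$ at $k$'' is by definition obtained by performing this on a symmetric unfolding and refolding. *)

(* Defs.v *)
From HB Require Import structures.
From mathcomp Require Import all_boot all_order all_algebra.
From mathcomp Require Import all_fingroup all_solvable.
From mathcomp Require Import zify.

Set Implicit Arguments.
Unset Strict Implicit.
Unset Printing Implicit Defensive.

Import Order.TTheory GRing.Theory Num.Theory GroupScope.
Local Open Scope ring_scope.

(* The group algebra R[gT]. An alias of {ffun gT -> R} is needed because the
   library already equips ffuns with the pointwise product. *)
Definition gring (R : comNzRingType) (gT : finGroupType) : Type :=
  {ffun gT -> R}.

Section GroupRing.
Variables (R : comNzRingType) (gT : finGroupType).
Local Notation A := (gring R gT).
Implicit Types a b c : A.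

HB.instance Definition _ := GRing.Zmodule.copy A {ffun gT -> R}.

Definition gelt (g : gT) : A := [ffun h => (h == g)%:R].
Definition gring_mul a b : A := [ffun g => \sum_h a h * b (h^-1 * g)%g].
Definition gring_scale (r : R) a : A := [ffun g => r * a g].

Fact gring_mulA : associative gring_mul.
Proof.
move=> a b c; apply/ffunP=> g; rewrite !ffunE.
under eq_bigr => h _ do rewrite ffunE big_distrr /=.
under [RHS]eq_bigr => h _ do rewrite ffunE big_distrl /=.
rewrite [RHS]exchange_big /=; apply: eq_bigr => h _.
rewrite [RHS](reindex_inj (mulgI h)) /=; apply: eq_bigr => h' _.
by rewrite mulrA mulKg invMg mulgA.
Qed.

Fact gring_mul1 : left_id (gelt 1) gring_mul.
Proof.
move=> a; apply/ffunP=> g; rewrite !ffunE (bigD1 1%g) //= big1 ?addr0.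
  by rewrite ffunE eqxx mul1r invg1 mul1g.
by move=> h /negPf h1; rewrite ffunE h1 mul0r.
Qed.

Fact gring_mulr1 : right_id (gelt 1) gring_mul.
Proof.
move=> a; apply/ffunP=> g; rewrite !ffunE (bigD1 g) //= big1 ?addr0.
  by rewrite ffunE mulVg eqxx mulr1.
move=> h /negPf hg; rewrite ffunE; case: eqP => [e|]; last by rewrite mulr0.
by move/eqP: e; rewrite -eq_mulVg1 hg.
Qed.

Fact gring_mulDl : left_distributive gring_mul +%R.
Proof.
move=> a b c; apply/ffunP=> g; rewrite !ffunE -big_split /=.
by apply: eq_bigr => h _; rewrite ffunE mulrDl.
Qed.

Fact gring_mulDr : right_distributive gring_mul +%R.
Proof.
move=> a b c; apply/ffunP=> g; rewrite !ffunE -big_split /=.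
by apply: eq_bigr => h _; rewrite ffunE mulrDr.
Qed.

Fact gring_1_neq0 : gelt 1 != 0.
Proof.
by apply/eqP=> /ffunP/(_ 1%g); rewrite !ffunE eqxx; apply/eqP/oner_neq0.
Qed.

HB.instance Definition _ := GRing.Zmodule_isNzRing.Build A
  gring_mulA gring_mul1 gring_mulr1 gring_mulDl gring_mulDr gring_1_neq0.

Fact gring_scaleA r s a :
  gring_scale r (gring_scale s a) = gring_scale (r * s) a.
Proof. by apply/ffunP=> g; rewrite !ffunE mulrA. Qed.
Fact gring_scale1 : left_id 1 gring_scale.
Proof. by move=> a; apply/ffunP=> g; rewrite !ffunE mul1r. Qed.
Fact gring_scaleDr : right_distributive gring_scale +%R.
Proof. by move=> r a b; apply/ffunP=> g; rewrite !ffunE mulrDr. Qed.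
Fact gring_scaleDl a : {morph gring_scale^~ a : r s / r + s}.
Proof. by move=> r s; apply/ffunP=> g; rewrite !ffunE mulrDl. Qed.

HB.instance Definition _ := GRing.Zmodule_isLmodule.Build R A
  gring_scaleA gring_scale1 gring_scaleDr gring_scaleDl.

Fact gring_scaleAl (r : R) a b : r *: (a * b) = r *: a * b.
Proof.
apply/ffunP=> g; rewrite !ffunE big_distrr /=.
by apply: eq_bigr => h _; rewrite ffunE mulrA.
Qed.

HB.instance Definition _ := GRing.Lmodule_isLalgebra.Build R A gring_scaleAl.

Fact gring_scaleAr (r : R) a b : r *: (a * b) = a * (r *: b).
Proof.
apply/ffunP=> g; rewrite !ffunE big_distrr /=.
by apply: eq_bigr => h _; rewrite ffunE mulrCA.
Qed.

HB.instance Definition _ := GRing.Lalgebra_isAlgebra.Build R A gring_scaleAr.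

Lemma gring_sumE (I : Type) (r : seq I) (P : pred I) (F : I -> A) g :
  (\sum_(i <- r | P i) F i : A) g = \sum_(i <- r | P i) F i g.
Proof. by elim/big_rec2: _ => [|i y a _ <-]; rewrite ffunE. Qed.

End GroupRing.

Arguments gelt {R gT} g.

Definition gpos (gT : finGroupType) (a : gring rat gT) : gring rat gT :=
  [ffun g => Num.max (a g) 0].
Definition gneg (gT : finGroupType) (a : gring rat gT) : gring rat gT :=
  [ffun g => Num.min (a g) 0].

Notation "[ a ]_+" := (gpos a) (at level 0, a at level 99, format "[ a ]_+").
Notation "[ a ]_-" := (gneg a) (at level 0, a at level 99, format "[ a ]_-").

Definition gcirc (gT : finGroupType) (a b : gring rat gT) : gring rat gT :=
  [a]_+ * [b]_+ - [a]_- * [b]_-.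

(* Arrows are recorded by their multiplicities: arr Q u v is the number of
   arrows from u to v. *)
Record quiver (V : finType) := Quiver {
  arr :> V -> V -> nat;
  quiver_noloop : forall v, arr v v = 0%N;
  quiver_no2cycle : forall u v, arr u v = 0%N \/ arr v u = 0%N
}.

Definition exch (V : finType) (Q : quiver V) (u v : V) : int :=
  (Q u v)%:Z - (Q v u)%:Z.

Section Mutation.
Variables (V : finType) (Q : quiver V).

Section AtNode.
Variable v : V.

Definition mut_compose (u w : V) : nat := (Q u w + Q u v * Q v w)%N.

(* Truncated subtraction: cancels a maximal set of oriented 2-cycles. *)
Definition mut_cancel (u w : V) : nat :=
  (mut_compose u w - mut_compose w u)%N.

Definition mut_arr (u w : V) : nat :=
  if (u == v) || (w == v) then mut_cancel w u else mut_cancel u w.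

Fact mut_noloop u : mut_arr u u = 0%N.
Proof. by rewrite /mut_arr /mut_cancel subnn if_same. Qed.

Fact mut_no2cycle u w : mut_arr u w = 0%N \/ mut_arr w u = 0%N.
Proof. by rewrite /mut_arr /mut_cancel orbC; case: ifP => _; lia. Qed.

Definition mut : quiver V := Quiver mut_noloop mut_no2cycle.

End AtNode.

(* The node v of Q becomes the node s v of relabel s. *)
Section Relabel.
Variable s : {perm V}.

Definition relabel_arr (u w : V) : nat := Q ((s^-1)%g u) ((s^-1)%g w).

Fact relabel_noloop u : relabel_arr u u = 0%N.
Proof. exact: quiver_noloop. Qed.

Fact relabel_no2cycle u w : relabel_arr u w = 0%N \/ relabel_arr w u = 0%N.
Proof. exact: quiver_no2cycle. Qed.

Definition relabel : quiver V := Quiver relabel_noloop relabel_no2cycle.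

End Relabel.
End Mutation.

Section Action.
Variables (gT : finGroupType) (V : finType) (to : {action gT &-> V}).

(* Library actions are right actions; this is the corresponding left action.
   Orbits and stabilisers are the same for both. *)
Definition lact (g : gT) (v : V) : V := to v g^-1%g.

Definition quiver_invariant (Q : quiver V) : Prop :=
  forall (g : gT) (u v : V), exch Q (lact g u) (lact g v) = exch Q u v.

Definition orbit_representatives (m : nat) (x : 'I_m -> V) : Prop :=
  forall v : V, exists! i : 'I_m, v \in orbit to [set: gT] (x i).

(* Z[gT][1/|gT|] is viewed inside Q[gT]; see folded_mx_localized. *)
Definition folded_mx (Q : quiver V) (m : nat) (x : 'I_m -> V) :
    'M[gring rat gT]_m :=
  \matrix_(i, j) ((#|'C[x j | to]|%:R : rat)^-1 *:
    \sum_(g : gT) ((exch Q (x i) (lact g (x j)))%:~R : rat) *: gelt g).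

Lemma folded_mx_localized (Q : quiver V) m (x : 'I_m -> V) i j g :
  (#|gT|%:R * folded_mx Q x i j g : rat) \is a Num.int.
Proof.
rewrite mxE ffunE mulrA rpredM //.
  have /dvdnP[q e] : (#|'C[x j | to]| %| #|gT|)%N.
    by rewrite -cardsT cardSg ?subsetT.
  by rewrite e natrM mulfK ?pnatr_eq0 -?lt0n ?cardG_gt0 // natr_int.
rewrite gring_sumE.
by apply: rpred_sum => h _; rewrite !ffunE rpredM // ?intr_int ?natr_int.
Qed.

End Action.

Definition generalized_mutation (gT : finGroupType) (V : finType)
    (to : {action gT &-> V}) (w : gT) (Q : quiver V) (xk : V) : quiver V :=
  let k1 := xk in
  let k2 := lact to w xk in
  let k3 := lact to (w ^+ 2)%g xk in
  relabel (mut (mut (mut (mut Q k1) k2) k3) k1) (tperm k2 k3).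

(* Main.v *)
(* Outside the orbit of x_k the four mutations are governed by the vectors
   a_i = beta_{u, k_i} and c_i = beta_{k_i, v}: writing [tri_row] for the new
   a_1, they add to beta_{u, v} the sum [tri_corr] of one mutation term for
   each of the four steps.  Cyclic rotation of (k_1, k_2, k_3) preserves
   [tri_corr], although the mutation sequence is not symmetric.  Hence the new
   quiver is given by formulas that may be based at any node of the orbit,
   which makes it G-invariant.  Averaging them over the three base nodes turns
   the sum of the mutation terms into products in the group ring, whence the
   factor 1/3. *)

Require Import Defs.
From mathcomp Require Import all_boot all_order all_algebra.
From mathcomp Require Import all_fingroup all_solvable.
From mathcomp Require Import zify ring.

Set Implicit Arguments.
Unset Strict Implicit.
Unset Printing Implicit Defensive.

Import Order.TTheory GRing.Theory Num.Theory.
Local Open Scope ring_scope.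

(** * Integer identities for the mutation terms *)

(** For a = beta_{uv} and c = beta_{vw} this is the number of paths u -> v -> w minus the number of
    paths w -> v -> u. It is the integer counterpart of [gcirc]. *)
Definition pprod (a c : int) : int :=
  Num.max a 0 * Num.max c 0 - Num.min a 0 * Num.min c 0.

Definition tri_row (a1 a2 a3 : int) : int :=
  a1 - Num.max (a2 + Num.max a1 0) 0 - Num.min (a3 + Num.min a1 0) 0.

Definition tri_corr (a1 a2 a3 c1 c2 c3 : int) : int :=
  pprod a1 c1 - pprod (tri_row a1 a2 a3) (tri_row c1 c3 c2)
  + pprod (a2 + Num.max a1 0) (c2 + Num.min c1 0)
  + pprod (a3 + Num.min a1 0) (c3 + Num.max c1 0).

Lemma pprodC a c : pprod a c = pprod c a.
Proof. by rewrite /pprod mulrC [X in _ - X]mulrC. Qed.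

Lemma pprodr0 a : pprod a 0 = 0.
Proof. by rewrite /pprod maxxx minxx !mulr0 subrr. Qed.

Lemma pprodr1 a : pprod a 1 = Num.max a 0.
Proof.
by rewrite /pprod (max_l (@ler01 int)) (min_r (@ler01 int)) mulr1 mulr0
  subr0.
Qed.

Lemma pprodrN1 a : pprod a (-1) = Num.min a 0.
Proof.
by rewrite /pprod (max_r (@lerN10 int)) (min_l (@lerN10 int)) mulr0 mulrN1 sub0r
  opprK.
Qed.

Lemma pprodNN a c : pprod (- a) (- c) = - pprod a c.
Proof.
have opp_max (z : int) : Num.max (- z) 0 = - Num.min z 0 by lia.
have opp_min (z : int) : Num.min (- z) 0 = - Num.max z 0 by lia.
by rewrite /pprod !opp_max !opp_min; ring.
Qed.

(** Negation exchanges the two truncations, so the last two arguments trade places. This turns row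
    formulas into column formulas. *)
Lemma tri_rowN a1 a2 a3 : tri_row (- a1) (- a2) (- a3) = - tri_row a1 a3 a2.
Proof. by rewrite /tri_row; lia. Qed.

(* Both sides are bilinear in the truncations of the a's and of the c's, so the
   identity follows formally from the three linear relations [rel1], [rel2],
   [rel3] between these truncations. *)
Lemma tri_corr_rot a1 a2 a3 c1 c2 c3 :
  tri_corr a1 a2 a3 c1 c2 c3 = tri_corr a2 a3 a1 c2 c3 c1.
Proof.
have minE (z : int) : Num.min z 0 = z - Num.max z 0 by lia.
have rel1 (x y : int) : Num.max (y + Num.max x 0) 0
    = Num.max (x + (y - Num.max y 0)) 0 + Num.max y 0 by lia.
have rel2 (x y z : int) : Num.max (tri_row x y z) 0
    = Num.max (z + Num.max y 0) 0 + Num.max x 0 - z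
      - Num.max (x + (y - Num.max y 0)) 0 - Num.max y 0.
  by rewrite /tri_row; lia.
have rel3 (x y z : int) : Num.max (tri_row y z x) 0
    = Num.max x 0 + Num.max (z + (x - Num.max x 0)) 0 + Num.max y 0 - x
      - Num.max (z + Num.max y 0) 0.
  by rewrite /tri_row; lia.
rewrite /tri_corr /pprod !minE (rel2 a1 a2 a3) (rel3 a1 a2 a3).
(* The column formula runs through the triangle backwards, so the relations are applied to the c's
   in the order c2, c1, c3. *)
rewrite (rel2 c2 c1 c3) (rel3 c2 c1 c3) /tri_row !minE.
by rewrite (rel1 a1 a2) (rel1 c2 c1); ring.
Qed.

(** * Exchange matrices under mutation, and mutation along an oriented triangle *)

Section QuiverMutation.
Variable V : finType.
Implicit Types (Q : quiver V) (u v w : V).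

Lemma exchN Q u v : exch Q v u = - exch Q u v.
Proof. by rewrite /exch opprB. Qed.

Lemma exchii Q u : exch Q u u = 0.
Proof. by rewrite /exch subrr. Qed.

(** Without 2-cycles the positive and negative parts of beta are arrow counts, and the two opposite
    truncated subtractions combine into an ordinary difference. *)
Lemma exch_mut Q v u w :
  exch (mut Q v) u w =
    if (u == v) || (w == v) then - exch Q u w
    else exch Q u w + pprod (exch Q u v) (exch Q v w).
Proof.
have maxE a b : Q a b = 0%N \/ Q b a = 0%N -> Num.max (exch Q a b) 0 = Q a b.
  by rewrite /exch; lia.
have minE a b :
    Q a b = 0%N \/ Q b a = 0%N -> Num.min (exch Q a b) 0 = - (Q b a)%:Z.
  by rewrite /exch; lia.
have cancelE a b : (mut_cancel Q v a b)%:Z - (mut_cancel Q v b a)%:Z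
    = exch Q a b + pprod (exch Q a v) (exch Q v b).
  rewrite /pprod !maxE ?minE; try exact: quiver_no2cycle.
  by rewrite /mut_cancel /mut_compose /exch; lia.
rewrite {1}/exch /= /mut_arr orbC; case: ifP => [|_]; last exact: cancelE.
(* A pair containing v gets no correction, because one factor is beta_{vv} = 0. *)
rewrite cancelE exchN => /orP[]/eqP ->; rewrite exchii.
  by rewrite /pprod maxxx minxx !mul0r subrr addr0.
by rewrite pprodr0 addr0.
Qed.

Lemma exch_relabel Q (s : {perm V}) u v :
  exch (relabel Q s) u v = exch Q ((s^-1)%g u) ((s^-1)%g v).
Proof. by []. Qed.

Section Triangle.
Variables (Q : quiver V) (y1 y2 y3 : V).
Hypotheses (e12 : exch Q y1 y2 = 1) (e23 : exch Q y2 y3 = 1)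
  (e31 : exch Q y3 y1 = 1).

Let Q' := relabel (mut (mut (mut (mut Q y1) y2) y3) y1) (tperm y2 y3).

Let ne12 : (y1 == y2) = false.
Proof. by apply/eqP=> e; move: e12; rewrite e exchii. Qed.
Let ne23 : (y2 == y3) = false.
Proof. by apply/eqP=> e; move: e23; rewrite e exchii. Qed.
Let ne31 : (y3 == y1) = false.
Proof. by apply/eqP=> e; move: e31; rewrite e exchii. Qed.
Let ne21 : (y2 == y1) = false. Proof. by rewrite eq_sym. Qed.
Let ne32 : (y3 == y2) = false. Proof. by rewrite eq_sym. Qed.
Let ne13 : (y1 == y3) = false. Proof. by rewrite eq_sym. Qed.
Let e21 : exch Q y2 y1 = -1. Proof. by rewrite exchN e12. Qed.
Let e32 : exch Q y3 y2 = -1. Proof. by rewrite exchN e23. Qed.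
Let e13 : exch Q y1 y3 = -1. Proof. by rewrite exchN e31. Qed.

Let neE := (eqxx, ne12, ne23, ne31, ne21, ne32, ne13, orbT, orbF).
Let eE := (e12, e23, e31, e21, e32, e13, exchii).

Let tpermE : (tperm y2 y3 y1 = y1) * (tperm y2 y3 y2 = y3)
  * (tperm y2 y3 y3 = y2).
Proof. by rewrite tpermL tpermR tpermD ?ne21 ?ne31. Qed.

(** Throughout the sequence the entries between triangle nodes stay in {0, 1, -1}, so for u outside
    the triangle each mutation only adds a truncation of an entry of row u. The final transposition
    is what makes the three formulas cyclic rotations of one another. *)
Lemma exch_triangle_row u :
  [/\ exch Q' u y1 = tri_row (exch Q u y1) (exch Q u y2) (exch Q u y3),
      exch Q' u y2 = tri_row (exch Q u y2) (exch Q u y3) (exch Q u y1)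
    & exch Q' u y3 = tri_row (exch Q u y3) (exch Q u y1) (exch Q u y2)].
Proof.
rewrite /Q' !exch_relabel !tpermV !tpermE.
case: (eqVneq u y1) => [->|u1].
  by rewrite tpermE !(exch_mut, neE, eE) /=.
case: (eqVneq u y2) => [->|u2].
  by rewrite tpermE !(exch_mut, neE, eE) /=.
case: (eqVneq u y3) => [->|u3].
  by rewrite tpermE !(exch_mut, neE, eE) /=.
have uE := (negPf u1, negPf u2, negPf u3).
rewrite tpermD 1?eq_sym // !(exch_mut, neE, eE, uE) /=.
by rewrite !(pprodr0, pprodr1, pprodrN1) /tri_row; split;
  move: (exch Q u y1) (exch Q u y2) (exch Q u y3) => a1 a2 a3; clear; lia.
Qed.

Lemma exch_triangle_corr u v :
  u \notin [:: y1; y2; y3] -> v \notin [:: y1; y2; y3] ->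
  exch Q' u v = exch Q u v
    + tri_corr (exch Q u y1) (exch Q u y2) (exch Q u y3)
        (exch Q y1 v) (exch Q y2 v) (exch Q y3 v).
Proof.
rewrite !inE !negb_or => /and3P[u1 u2 u3] /and3P[v1 v2 v3].
have uE := (negPf u1, negPf u2, negPf u3, negPf v1, negPf v2, negPf v3).
rewrite /Q' !exch_relabel !tpermV !tpermD 1?eq_sym //.
rewrite !(exch_mut, neE, eE, uE) /=.
rewrite (pprodr1 1) (pprodrN1 (-1)) !(pprodC (-1)) !(pprodC 1).
(* The first mutation cancels the arrow between y2 and y3, so the next two mutations do not
   interact. *)
rewrite [1 + _](_ : _ = 0) // [-1 + _](_ : _ = 0) // opprK.
rewrite !(pprodC 0) !(pprodr0, pprodr1, pprodrN1) !addr0.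
(* The fourth mutation, again at y1, meets the negatives of the final entries there; this yields the
   negative term of [tri_corr]. *)
have pprodR (a c a' c' : int) : a = - a' -> c = - c' ->
    pprod a c = - pprod a' c'.
  by move=> -> ->; exact: pprodNN.
rewrite (pprodR (- exch Q u y1 + _ + _) (- exch Q y1 v + _ + _)
  (tri_row (exch Q u y1) (exch Q u y2) (exch Q u y3))
  (tri_row (exch Q y1 v) (exch Q y3 v) (exch Q y2 v))).
- by rewrite /tri_corr; ring.
- by rewrite /tri_row; ring.
- by rewrite /tri_row; ring.
Qed.

End Triangle.

End QuiverMutation.

(** * Group ring elements with integer coefficients up to a common scalar *)

Section GroupRingCoefficients.
Variable gT : finGroupType.
Implicit Types (r : rat) (f : gT -> int) (g : gT).

(** Folded entries have this shape with r = 1/|H_j|. As truncation commutes with scaling by r >= 0,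
    identities in the group ring reduce to integer ones. *)
Definition gfun r f : gring rat gT := [ffun g => r * (f g)%:~R].

Lemma eq_gfun r f1 f2 : f1 =1 f2 -> gfun r f1 = gfun r f2.
Proof. by move=> e; apply/ffunP=> g; rewrite !ffunE e. Qed.

Lemma gfunD r f1 f2 : gfun r f1 + gfun r f2 = gfun r (fun g => f1 g + f2 g).
Proof. by apply/ffunP=> g; rewrite !ffunE rmorphD mulrDr. Qed.

Lemma gfunB r f1 f2 : gfun r f1 - gfun r f2 = gfun r (fun g => f1 g - f2 g).
Proof. by apply/ffunP=> g; rewrite !ffunE rmorphB mulrBr. Qed.

Lemma gelt_gfun r f h : gelt h * gfun r f = gfun r (fun g => f (h^-1 * g)%g).
Proof.
apply/ffunP=> g; rewrite !ffunE (bigD1 h) //= big1 => [|h' /negPf h'h].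
  by rewrite !ffunE eqxx mul1r addr0.
by rewrite ffunE h'h mul0r.
Qed.

Lemma gpos_gfun r f :
  0 <= r -> [gfun r f]_+ = gfun r (fun g => Num.max (f g) 0).
Proof.
move=> r0; apply/ffunP=> g; rewrite !ffunE -{1}(mulr0 r) -maxr_pMr //.
by congr (_ * _); case: (leP (f g) 0) => f0; [apply: max_r | apply: max_l];
  rewrite (ler_int rat _ 0, ler_int rat 0) // ltW.
Qed.

Lemma gneg_gfun r f :
  0 <= r -> [gfun r f]_- = gfun r (fun g => Num.min (f g) 0).
Proof.
move=> r0; apply/ffunP=> g; rewrite !ffunE -{1}(mulr0 r) -minr_pMr //.
by congr (_ * _); case: (leP (f g) 0) => f0; [apply: min_l | apply: min_r];
  rewrite (ler_int rat _ 0, ler_int rat 0) // ltW.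
Qed.

Lemma gcirc_gfun r1 r2 f1 f2 : 0 <= r1 -> 0 <= r2 ->
  gcirc (gfun r1 f1) (gfun r2 f2)
    = gfun (r1 * r2) (fun g => \sum_h pprod (f1 h) (f2 (h^-1 * g)%g)).
Proof.
move=> r10 r20; rewrite /gcirc !gpos_gfun // !gneg_gfun //.
apply/ffunP=> g; rewrite !ffunE -sumrB rmorph_sum /= mulr_sumr.
by apply: eq_bigr => h _; rewrite !ffunE /pprod rmorphB !rmorphM /=; ring.
Qed.

End GroupRingCoefficients.

(** * Folding, and invariance under the group of order 3 *)

Section Folding.
Variables (gT : finGroupType) (V : finType) (to : {action gT &-> V}).
Implicit Types (Q : quiver V) (u v : V) (g h : gT).

Lemma lact1 v : lact to 1 v = v.
Proof. by rewrite /lact invg1 act1. Qed.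

Lemma lactM g h v : lact to (g * h) v = lact to g (lact to h v).
Proof. by rewrite /lact invMg actM. Qed.

Lemma lact_orbit g v : lact to g v \in orbit to [set: gT] v.
Proof. by apply/orbitP; exists g^-1%g; rewrite ?inE. Qed.

Lemma folded_mxE Q m (x : 'I_m -> V) i j :
  folded_mx to Q x i j
    = gfun (#|('C[x j | to])%g|%:R)^-1
        (fun g => exch Q (x i) (lact to g (x j))).
Proof.
rewrite mxE; apply/ffunP=> g; rewrite !ffunE gring_sumE (bigD1 g) //=.
rewrite big1 => [|h /negPf hg]; first by rewrite !ffunE eqxx mulr1 addr0.
by rewrite !ffunE eq_sym hg mulr0.
Qed.

Lemma exch_lactl Q g u v : quiver_invariant to Q ->
  exch Q (lact to g u) v = exch Q u (lact to g^-1%g v).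
Proof. by move=> invQ; rewrite -(invQ g^-1%g) -lactM mulVg lact1. Qed.

Section OrderThree.
Variables (w : gT).
Hypotheses (card_gT : #|gT| = 3%N) (gen_w : generator [set: gT] w).

Lemma order3_expg3 : (w ^+ 3 = 1)%g.
Proof. by rewrite -card_gT -cardsT expg_cardG ?inE. Qed.

Lemma order3_cases g : [\/ g = 1%g, g = w | g = (w ^+ 2)%g].
Proof.
have /cycleP[n ->] : g \in <[w]>%g by rewrite -(eqP gen_w) inE.
rewrite -(expg_mod n order3_expg3).
have := ltn_pmod n (isT : 0 < 3)%N; case: (n %% 3)%N => [|[|[|]]] // _.
- exact: Or31.
- exact: Or32.
- exact: Or33.
Qed.

Lemma order3_commute g : (w * g = g * w)%g.
Proof.
by case: (order3_cases g) => ->; rewrite ?mulg1 ?mul1g // -expgS -expgSr.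
Qed.

Lemma order3_commuteV g : (w^-1 * g = g * w^-1)%g.
Proof. by apply: (mulgI w); rewrite mulKVg mulgA order3_commute mulgK. Qed.

Lemma order3_invg : (w^-1 = w ^+ 2)%g.
Proof. by apply/eqP; rewrite eq_invg_mul -expgS order3_expg3. Qed.

Section FreeOrbit.
Variables (Q : quiver V) (y : V).
Hypotheses (invQ : quiver_invariant to Q)
  (exch_w : exch Q y (lact to w y) = 1).

Let Q' := generalized_mutation to w Q y.

Let exch_w2 : exch Q (lact to w y) (lact to (w ^+ 2)%g y) = 1.
Proof. by rewrite (expgS w 1) expg1 lactM invQ. Qed.

Let exch_w3 : exch Q (lact to (w ^+ 2)%g y) y = 1.
Proof.
have {2}-> : y = lact to (w ^+ 2)%g (lact to w y).
  by rewrite -lactM -expgSr order3_expg3 lact1.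
by rewrite invQ.
Qed.

(** The three row formulas are cyclic, so they merge into one formula in which w and its inverse
    lead to the next and the previous node. *)
Lemma exch_gm_row u g :
  exch Q' u (lact to g y)
    = tri_row (exch Q u (lact to g y)) (exch Q u (lact to (w * g) y))
        (exch Q u (lact to (w^-1 * g) y)).
Proof.
have [r1 r2 r3] := exch_triangle_row exch_w exch_w2 exch_w3 u.
have ww : (w * w = w ^+ 2)%g by rewrite (expgS w 1) expg1.
have w2w : (w ^+ 2 * w = 1)%g by rewrite -expgSr order3_expg3.
rewrite order3_invg; case: (order3_cases g) => ->.
- by rewrite !mulg1 lact1.
- by rewrite w2w lact1 ww.
- by rewrite -expgS order3_expg3 -expgD (expgS w 3) order3_expg3 mulg1 lact1.
Qed.

Lemma exch_gm_col v g :
  exch Q' (lact to g y) v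
    = tri_row (exch Q (lact to g y) v) (exch Q (lact to (w^-1 * g) y) v)
        (exch Q (lact to (w * g) y) v).
Proof. by rewrite exchN exch_gm_row -tri_rowN -!exchN. Qed.

(** The base node g y is arbitrary thanks to [tri_corr_rot]. This freedom serves both the invariance
    and the averaging. *)
Lemma exch_gm_corr u v g :
  (forall h, u != lact to h y) -> (forall h, v != lact to h y) ->
  exch Q' u v = exch Q u v
    + tri_corr (exch Q u (lact to g y)) (exch Q u (lact to (w * g) y))
        (exch Q u (lact to (w^-1 * g) y)) (exch Q (lact to g y) v)
        (exch Q (lact to (w * g) y) v) (exch Q (lact to (w^-1 * g) y) v).
Proof.
move=> uy vy; have notin t : (forall h, t != lact to h y) ->
    t \notin [:: y; lact to w y; lact to (w ^+ 2)%g y].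
  by move=> ty; rewrite !inE !negb_or -{1}[y]lact1 !ty.
have := exch_triangle_corr exch_w exch_w2 exch_w3 (notin u uy) (notin v vy).
have ww : (w * w = w ^+ 2)%g by rewrite (expgS w 1) expg1.
have w2w : (w ^+ 2 * w = 1)%g by rewrite -expgSr order3_expg3.
rewrite -/Q' order3_invg; case: (order3_cases g) => -> ->.
- by rewrite !mulg1 lact1.
- by rewrite w2w lact1 ww tri_corr_rot.
- rewrite -expgS order3_expg3 -expgD (expgS w 3) order3_expg3 mulg1 lact1.
  by rewrite -tri_corr_rot.
Qed.

Lemma gm_invariant : quiver_invariant to Q'.
Proof.
have invQ'l g u h :
    exch Q' (lact to g u) (lact to g (lact to h y)) = exch Q' u (lact to h y).
  rewrite -lactM !exch_gm_row !mulgA (order3_commute g) (order3_commuteV g).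
  by rewrite -!mulgA !lactM !invQ.
have out_lact g v : (forall h, v != lact to h y) ->
    forall h, lact to g v != lact to h y.
  move=> vy h; apply: contraNneq (vy (g^-1 * h)%g) => e.
  by rewrite lactM -e -lactM mulVg lact1.
move=> g u v.
have [/existsP[h /eqP ->]|] := boolP [exists h, v == lact to h y].
  exact: invQ'l.
rewrite negb_exists => /forallP vy.
have [/existsP[h /eqP ->]|] := boolP [exists h, u == lact to h y].
  by rewrite exchN invQ'l -exchN.
rewrite negb_exists => /forallP uy.
(* With base g for the translated pair and base 1 for the original one, the two formulas agree term
   by term by invariance of Q. *)
rewrite (exch_gm_corr g (out_lact g u uy) (out_lact g v vy)).
rewrite (exch_gm_corr 1%g uy vy) !mulg1.
rewrite (order3_commute g) (order3_commuteV g).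
by rewrite !lactM !lact1 !invQ.
Qed.

End FreeOrbit.
End OrderThree.
End Folding.

(** * The folded matrix of the mutated quiver *)

Theorem proposition4p8 (gT : finGroupType) (w : gT)
    (card_gT : #|gT| = 3%N) (gen_w : generator [set: gT] w)
    (V : finType) (to : {action gT &-> V}) (Q : quiver V)
    (invQ : quiver_invariant to Q)
    (m : nat) (x : 'I_m -> V) (repr_x : orbit_representatives to x)
    (k : 'I_m)
    (bkk : folded_mx to Q x k k = gelt w - gelt w^-1%g) :
  let Q' := generalized_mutation to w Q (x k) in
  let b := folded_mx to Q x in
  let b' := folded_mx to Q' x in
  let om : gring rat gT := gelt w in
  let om_inv : gring rat gT := gelt w^-1%g in
  quiver_invariant to Q' /\
  forall i j : 'I_m,
    b' i j =
      if (i == k) || (j == k) then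
        b i j - [om_inv * b i j + [b i j]_+]_+ - [om * b i j + [b i j]_-]_-
      else
        b i j + (3%:R^-1 : rat) *:
          (gcirc (b i k) (b k j) - gcirc (b' i k) (b' k j)
           + gcirc (om_inv * b i k + [b i k]_+) (om * b k j + [b k j]_-)
           + gcirc (om * b i k + [b i k]_-) (om_inv * b k j + [b k j]_+)).
Proof.
move=> Q' b b' om om_inv.
have b_kk : b k k w = 1.
  have wN : (w == w^-1)%g = false.
    apply/negbTE/eqP=> e.
    have := card_gT; rewrite -cardsT (eqP gen_w) -orderE => ow.
    have : (#[w]%g %| 2)%N by rewrite order_dvdn (expgS w 1) expg1 {2}e mulgV.
    by rewrite ow.
  by rewrite /b bkk !ffunE eqxx wN subr0.
have /prime_nt_dvdP stabE : (#|'C[x k | to]%g| %| 3)%N.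
  by rewrite -card_gT -cardsT cardSg ?subsetT.
(* A stabiliser of order 3 would make w fix [x k], and the coefficient of w in b_kk would then be 0
   instead of 1. *)
have stab1 : #|'C[x k | to]%g| = 1%N.
  apply/eqP; apply: contraT => n1; have c3 := stabE isT n1.
  have /eqP cT : 'C[x k | to]%g == [set: gT].
    by rewrite eqEcard subsetT cardsT card_gT c3.
  have fix_w : lact to w (x k) = x k.
    by rewrite /lact; apply/astab1P; rewrite cT inE.
  by move: b_kk; rewrite /b folded_mxE ffunE fix_w exchii mulr0.
have exch_w : exch Q (x k) (lact to w (x k)) = 1.
  move: b_kk; rewrite /b folded_mxE ffunE stab1 invr1 mul1r.
  by rewrite -[1 in RHS](rmorph1 intr) => /intr_inj.
pose row := exch_gm_row card_gT gen_w invQ exch_w.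
pose col := exch_gm_col card_gT gen_w invQ exch_w.
have invQ' : quiver_invariant to Q' by apply: gm_invariant.
split=> // i j.
have r_ge0 l : 0 <= (#|'C[x l | to]%g|%:R : rat)^-1 by rewrite invr_ge0.
have out l g h : l != k -> lact to g (x l) != lact to h (x k).
  move=> lk; apply: contraNneq lk => e; apply/eqP.
  have [l' [_ uniq_l]] := repr_x (lact to g (x l)).
  rewrite -(uniq_l l) ?lact_orbit //; apply: uniq_l.
  by rewrite e lact_orbit.
case: ifPn => [|/norP[ik jk]].
  rewrite /om /om_inv /b /b' !folded_mxE !gelt_gfun.
  rewrite gpos_gfun // gneg_gfun // !gfunD gpos_gfun // gneg_gfun // !gfunB.
  move=> ijk; apply: eq_gfun => g; rewrite invgK.
  case/orP: ijk => /eqP ->; last by rewrite row.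
  (* Moving w from one argument of beta to the other inverts it; this undoes the swap in the column
     formula, so row and column k obey the same group ring formula. *)
  rewrite -[x k in LHS](lact1 to) col !mulg1 lact1 /tri_row.
  by rewrite !lactM !(exch_lactl _ _ _ invQ) !invgK.
rewrite /om /om_inv /b /b' !folded_mxE !gelt_gfun stab1 invr1 invgK.
rewrite !(gpos_gfun, gneg_gfun, gfunD) // !gcirc_gfun // !mul1r gfunB !gfunD.
apply/ffunP=> g; rewrite !ffunE -sumrB -!big_split /=.
(* This exhibits the second factor of the convolution as an entry based at the node h x_k. *)
have shift P h : quiver_invariant to P ->
    exch P (x k) (lact to (h^-1 * g) (x j))
      = exch P (lact to h (x k)) (lact to g (x j)).
  by move=> invP; rewrite lactM (exch_lactl h _ _ invP).
have out1 h : x i != lact to h (x k) by rewrite -[x i](lact1 to) out.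
(* The summand for h is the correction based at h x_k, hence the whole change of beta whatever h is.
   The sum over the group is three times this change. *)
rewrite (eq_bigr (fun=> exch Q' (x i) (lact to g (x j))
                        - exch Q (x i) (lact to g (x j)))) => [|h _].
  move: (exch Q' _ _) (exch Q _ _) (_^-1) => c a r.
  by rewrite sumr_const card_gT rmorphMn rmorphB /=; field.
have wh : (w^-1 * (h^-1 * g) = (w * h)^-1 * g)%g.
  by rewrite (order3_commute card_gT gen_w) invMg mulgA.
have wVh : (w * (h^-1 * g) = (w^-1 * h)^-1 * g)%g.
  by rewrite (order3_commuteV card_gT gen_w) invMg invgK mulgA.
rewrite wh wVh !shift // row col.
rewrite (exch_gm_corr card_gT gen_w invQ exch_w h out1 (out _ g ^~ jk)).
by rewrite [RHS]addrC addKr.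
Qed.
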